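(* Let $c_1,\ldots,c_5\in\mathbb{R}$ with $c_4\neq0$, and let $B_1,B_2,w,g_{13},h,G$ (and $B_3$) be as defined in the context. Then for sufficiently small $t>0$, $$P_{\mathbb{S}^3_+}(G(t))=G(t)+\begin{pmatrix}0&*&*\\[1ex] -\dfrac{t^7}{8c_4^4}& h-\dfrac{\langle B_2,B_1\rangle}{8c_4^5\|B_1\|^2}t^7&*\\[2ex] c_4h& c_5h-\dfrac{c_5\langle B_2,B_1\rangle}{8c_4^5\|B_1\|^2}t^7-\dfrac{\langle B_3,B_1\rangle}{8c_4^4\|B_1\|^2}t^7&\dfrac{g_{13}^2}{w}\end{pmatrix}+O(t^8),$$ where the entries $*$ are determined by symmetry of the matrix.
   Context: $\mathbb{S}^3$ is the space of real symmetric $3\times3$ matrices with inner product $\langle A,B\rangle=\operatorname{tr}(A^TB)$ and Frobenius norm $\|\cdot\|$; $\mathbb{S}^3_+$ is the cone of positive semidefinite matrices and $P_{\mathbb{S}^3_+}$ the nearest-point projection onto it. $O(t^m)$ is as $t\to0$, entrywise for matrices. Let $c_1,\ldots,c_5\in\mathbb{R}$, $c_4\ne0$, $U_*=\begin{pmatrix}1&0&0\\0&0&0\\0&0&0\end{pmatrix}$ and $$B_1=\begin{pmatrix}-2c_1&1&0\\1&0&0\\0&0&0\end{pmatrix},\quad B_2=\begin{pmatrix}2c_2&0&-1\\0&2c_4&0\\-1&0&0\end{pmatrix},\quad B_3=\begin{pmatrix}-2c_3&0&0\\0&-2c_5&1\\0&1&0\end{pmatrix}.$$ Define the following rational functions of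 $t$ (near $t=0$): $$w=1-2c_1t+\frac{c_2t^2}{c_4\Big(1-2c_1t+\frac{c_2t^2}{c_4(1-2c_1t)+c_5t}+\frac{c_3t^3}{c_4}\Big)+c_5t}+\frac{c_3t^3}{\Big(c_4\big(1-2c_1t+\frac{c_2t^2}{c_4}\big)+c_5t\Big)\big(1-2c_1t+\frac{c_2t^2}{c_4}\big)},$$ $$\tilde g_{13}=\frac{t^2}{2c_4w+2c_5t}-\frac{2(2c_5^2+1)t^6}{(2c_4w+2c_5t)^5},\qquad r_0=\frac{c_4\langle B_3,B_1\rangle+c_5\langle B_2,B_1\rangle}{8c_4^5\|B_1\|^2}+\frac1{8c_4^3},$$ $$r_{13}=\frac{c_5}{c_4}r_0t^7+\frac{\langle B_2,B_1\rangle}{16c_4^6\|B_1\|^2}t^7,\qquad r_{23}=-\frac{2c_5t^6}{(2c_4w+2c_5t)^4w}+r_0t^7,$$ $$g_{13}=\tilde g_{13}+r_{13},\qquad g_{23}=-\frac{\tilde g_{13}}{w}t+r_{23},\qquad h=\frac{2t^6}{(2c_4w+2c_5t)^4w},$$ $$G(t)=U_*+tB_1+g_{13}B_2+g_{23}B_3=\begin{pmatrix}1-2c_1t+2c_2g_{13}-2c_3g_{23}&t&-g_{13}\\t&2c_4g_{13}-2c_5g_{23}&g_{23}\\-g_{13}&g_{23}&0\end{pmatrix}.$$ *)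

(* Defs.v *)
From HB Require Import structures.
From mathcomp Require Import all_boot all_order all_algebra.
From mathcomp Require Import all_classical all_reals all_analysis.

Set Implicit Arguments.
Unset Strict Implicit.
Unset Printing Implicit Defensive.

Import Order.TTheory GRing.Theory Num.Theory.
Import numFieldNormedType.Exports.

Local Open Scope classical_set_scope.
Local Open Scope ring_scope.

Section PsdProjection.
Context {R : realType} {n : nat}.
Implicit Types (A B X : 'M[R]_n) (C : set 'M[R]_n).

Definition frob_inner A B : R := \tr (A^T *m B).

Definition frob_norm A : R := Num.sqrt (frob_inner A A).

Definition psd_cone : set 'M[R]_n :=
  [set A | A^T = A /\ forall x : 'cV[R]_n, 0 <= (x^T *m A *m x) 0 0].

Definition nearest_points C X : set 'M[R]_n :=
  [set P | C P /\ forall Y, C Y -> frob_norm (X - P) <= frob_norm (X - Y)].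

(* For a nonempty closed convex C the nearest point exists and is unique; the
   default value 0 of xget plays no role then. *)
Definition nearest_point_proj C X : 'M[R]_n := xget 0 (nearest_points C X).

Definition psd_proj : 'M[R]_n -> 'M[R]_n := nearest_point_proj psd_cone.

End PsdProjection.

Definition mx3 {R : realType} (rows : seq (seq R)) : 'M[R]_3 :=
  \matrix_(i < 3, j < 3) nth 0 (nth [::] rows i) j.

(* Symmetric matrix given by its lower triangle, read row by row. *)
Definition sym3 {R : realType} (a11 a21 a22 a31 a32 a33 : R) : 'M[R]_3 :=
  mx3 [:: [:: a11; a21; a31];
          [:: a21; a22; a32];
          [:: a31; a32; a33]].

(* Divisions by zero, for which x / 0 = 0, do not occur near t = 0 when c4 != 0:
   all the denominators below are nonzero at t = 0. *)
Section Curve.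
Context {R : realType} (c1 c2 c3 c4 c5 : R).
Implicit Types t : R.

Definition Ustar : 'M[R]_3 :=
  mx3 [:: [:: 1; 0; 0];
          [:: 0; 0; 0];
          [:: 0; 0; 0]].

Definition B1 : 'M[R]_3 :=
  mx3 [:: [:: - (2 * c1); 1; 0];
          [:: 1; 0; 0];
          [:: 0; 0; 0]].

Definition B2 : 'M[R]_3 :=
  mx3 [:: [:: 2 * c2; 0; - 1];
          [:: 0; 2 * c4; 0];
          [:: - 1; 0; 0]].

Definition B3 : 'M[R]_3 :=
  mx3 [:: [:: - (2 * c3); 0; 0];
          [:: 0; - (2 * c5); 1];
          [:: 0; 1; 0]].

Definition w t : R :=
  1 - 2 * c1 * t
  + c2 * t ^+ 2 /
    (c4 * (1 - 2 * c1 * t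
           + c2 * t ^+ 2 / (c4 * (1 - 2 * c1 * t) + c5 * t)
           + c3 * t ^+ 3 / c4)
     + c5 * t)
  + c3 * t ^+ 3 /
    ((c4 * (1 - 2 * c1 * t + c2 * t ^+ 2 / c4) + c5 * t)
     * (1 - 2 * c1 * t + c2 * t ^+ 2 / c4)).

Definition tg13 t : R :=
  t ^+ 2 / (2 * c4 * w t + 2 * c5 * t)
  - 2 * (2 * c5 ^+ 2 + 1) * t ^+ 6 / (2 * c4 * w t + 2 * c5 * t) ^+ 5.

Definition r0 : R :=
  (c4 * frob_inner B3 B1 + c5 * frob_inner B2 B1)
    / (8 * c4 ^+ 5 * frob_norm B1 ^+ 2)
  + 1 / (8 * c4 ^+ 3).

Definition r13 t : R :=
  c5 / c4 * r0 * t ^+ 7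
  + frob_inner B2 B1 / (16 * c4 ^+ 6 * frob_norm B1 ^+ 2) * t ^+ 7.

Definition r23 t : R :=
  - (2 * c5 * t ^+ 6 / ((2 * c4 * w t + 2 * c5 * t) ^+ 4 * w t))
  + r0 * t ^+ 7.

Definition g13 t : R := tg13 t + r13 t.

Definition g23 t : R := - (tg13 t / w t) * t + r23 t.

Definition h t : R := 2 * t ^+ 6 / ((2 * c4 * w t + 2 * c5 * t) ^+ 4 * w t).

Definition G t : 'M[R]_3 := Ustar + t *: B1 + g13 t *: B2 + g23 t *: B3.

End Curve.

(* Main.v *)
(* Let v = (1, v2, v3) with G11 v2 = t - t^7 / (8 c4^4) and
   G11 v3 = c4 h - g13, where G11 is the top left entry of G(t), and let N be the
   symmetric matrix with N v = 0 whose lower right 2x2 block is that of the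
   claimed correction E. That block is positive definite for small t > 0: its
   diagonal entries are ~ t^6 / (8 c4^4) and ~ t^4 / (4 c4^2), and its
   off-diagonal entry is O(t^6). So N is positive semidefinite, and G11 v v^T is
   exactly the projection of G11 v v^T - N. Since G11 = w + O(t^6), power series
   computations modulo t^8 give G = G11 v v^T - N + O(t^8) and
   G + E = G11 v v^T + O(t^8); as the projection is 1-Lipschitz, the theorem
   follows. *)
Require Import Defs.
From HB Require Import structures.
From mathcomp Require Import all_boot all_order all_algebra.
From mathcomp Require Import all_classical all_reals all_analysis.
From mathcomp Require Import ring lra.

Import Order.TTheory GRing.Theory Num.Theory.
Import numFieldNormedType.Exports.

Local Open Scope classical_set_scope.
Local Open Scope ring_scope.

(** * Projection onto the positive semidefinite cone *)

Section FrobeniusInner.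
Context {R : realType} {n : nat}.
Implicit Types A B C : 'M[R]_n.

Lemma frob_innerE A B : frob_inner A B = \sum_i \sum_j A i j * B i j.
Proof.
rewrite /frob_inner /mxtrace exchange_big/=; apply: eq_bigr => j _.
by rewrite mxE; apply: eq_bigr => i _; rewrite mxE.
Qed.

Lemma frob_innerC A B : frob_inner A B = frob_inner B A.
Proof.
by rewrite !frob_innerE; do 2!(apply: eq_bigr => ? _); rewrite mulrC.
Qed.

Lemma frob_innerDl A B C : frob_inner (A + B) C = frob_inner A C + frob_inner B C.
Proof. by rewrite /frob_inner linearD mulmxDl linearD. Qed.

Lemma frob_innerZl (k : R) A B : frob_inner (k *: A) B = k * frob_inner A B.
Proof. by rewrite /frob_inner linearZ -scalemxAl linearZ. Qed.

Lemma frob_innerNl A B : frob_inner (- A) B = - frob_inner A B.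
Proof. by rewrite -scaleN1r frob_innerZl mulN1r. Qed.

Lemma frob_innerDr A B C : frob_inner A (B + C) = frob_inner A B + frob_inner A C.
Proof. by rewrite frob_innerC frob_innerDl !(frob_innerC A). Qed.

Lemma frob_innerZr (k : R) A B : frob_inner A (k *: B) = k * frob_inner A B.
Proof. by rewrite frob_innerC frob_innerZl frob_innerC. Qed.

Lemma frob_innerNr A B : frob_inner A (- B) = - frob_inner A B.
Proof. by rewrite frob_innerC frob_innerNl frob_innerC. Qed.

Definition frob_inner_lin := (frob_innerDl, frob_innerDr, frob_innerZl,
  frob_innerZr, frob_innerNl, frob_innerNr).

Lemma sqr_le_frob A i j : A i j ^+ 2 <= frob_inner A A.
Proof.
have ge0 k l : 0 <= A k l * A k l by rewrite -expr2 sqr_ge0.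
rewrite frob_innerE (bigD1 i)//= (bigD1 j)//= -expr2 -addrA lerDl addr_ge0//.
  exact: sumr_ge0.
by apply: sumr_ge0 => k _; exact: sumr_ge0.
Qed.

Lemma frob_ge0 A : 0 <= frob_inner A A.
Proof. by rewrite frob_innerE; do 2!(apply: sumr_ge0 => ? _); rewrite -expr2 sqr_ge0. Qed.

Lemma frob_norm_le A B :
  (frob_norm A <= frob_norm B) = (frob_inner A A <= frob_inner B B).
Proof. by rewrite /frob_norm ler_sqrt ?frob_ge0. Qed.

Lemma entry_le_frob_norm A i j : `|A i j| <= frob_norm A.
Proof. by rewrite -sqrtr_sqr ler_wsqrtr// sqr_le_frob. Qed.

(** Each [|A i j|] is at most the full sum S, so the sum of squares is at most S^2. This turns
    entrywise orders of vanishing into a bound on the norm. *)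
Lemma frob_norm_le_sum A : frob_norm A <= \sum_i \sum_j `|A i j|.
Proof.
have s0 : 0 <= \sum_i \sum_j `|A i j| by do 2!(apply: sumr_ge0 => ? _).
rewrite -[leRHS]ger0_norm// -sqrtr_sqr ler_wsqrtr// frob_innerE expr2.
rewrite mulr_suml; apply: ler_sum => i _.
rewrite mulr_suml; apply: ler_sum => j _.
rewrite (le_trans (ler_norm _))// normrM ler_wpM2l//.
rewrite (bigD1 i)//= (bigD1 j)//= -addrA lerDl addr_ge0//.
  exact: sumr_ge0.
by do 2!(apply: sumr_ge0 => ? _).
Qed.

Lemma frob_inner_dyad (v : 'cV[R]_n) A :
  frob_inner (v *m v^T) A = (v^T *m A *m v) 0 0.
Proof.
by rewrite /frob_inner trmx_mul trmxK -trace_mx11 [RHS]mxtrace_mulC mulmxA.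
Qed.

Lemma frob_inner_dyad2 (u v : 'cV[R]_n) :
  frob_inner (u *m u^T) (v *m v^T) = ((u^T *m v) 0 0) ^+ 2.
Proof.
rewrite frob_inner_dyad mulmxA -(mulmxA (u^T *m v)).
by rewrite mxE big_ord1 expr2 -[v^T *m u]trmxK trmx_mul trmxK [X in _ * X]mxE.
Qed.

End FrobeniusInner.

(** * Projections onto convex sets through the obtuse-angle inequality *)

Section NearestPoint.
Context {R : realType} {n : nat}.
Implicit Types A B P X Y : 'M[R]_n.

Definition obtuse (C : set 'M[R]_n) X P :=
  C P /\ forall Y, C Y -> frob_inner (X - P) (Y - P) <= 0.

(** Moving from P towards Y by a fraction s stays in C and cannot reduce the distance to X; the
    first-order term in s then gives the sign. *)
Lemma nearest_point_obtuse (C : set 'M[R]_n) X P :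
  (forall A B (s : R), C A -> C B -> 0 <= s <= 1 ->
     C (A + s *: (B - A))) ->
  nearest_points C X P -> obtuse C X P.
Proof.
move=> convC [CP minP]; split=> // Y CY.
set p := frob_inner _ _; set q := frob_inner (Y - P) (Y - P).
have q0 : 0 <= q := frob_ge0 _.
have key s : 0 <= s <= 1 -> s * (2 * p) <= s * (s * q).
  move=> s01; have := minP _ (convC _ _ _ CP CY s01).
  rewrite frob_norm_le opprD addrA.
  move: (X - P) (Y - P) @p @q q0 => U V p q q0.
  rewrite !frob_inner_lin (frob_innerC V U) -/p -/q => H; nra.
rewrite leNgt; apply/negP => p0.
have {}key s : 0 < s <= 1 -> 2 * p <= s * q.
  by move=> /andP[s0 s1]; rewrite -(ler_pM2l s0) key// ltW//=.
(* If p > 0, the fraction s = p / (p + q) lies in (0, 1] and has s q <= p, whereas minimality forces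
   2 p <= s q. *)
have pq : p / (p + q) * q <= p by rewrite mulrAC ler_pdivrMr; nra.
have : 2 * p <= p / (p + q) * q.
  by apply: key; rewrite divr_gt0 ?ler_pdivrMr//=; lra.
lra.
Qed.

(* Adding the two obtuse-angle inequalities, each tested at the other
   projection, gives |P - Q|^2 <= <X - Y, P - Q>. *)
Lemma obtuse_nonexpansive (C : set 'M[R]_n) X Y P Q :
  obtuse C X P -> obtuse C Y Q -> frob_norm (P - Q) <= frob_norm (X - Y).
Proof.
move=> [CP oP] [CQ oQ]; rewrite frob_norm_le.
have := oP _ CQ; have := oQ _ CP; have := frob_ge0 ((X - Y) - (P - Q)).
have -> : Y - Q = (X - P) - ((X - Y) - (P - Q)) by apply/matrixP=> i j; rewrite !mxE; ring.
have -> : X - Y = ((X - Y) - (P - Q)) + (P - Q) by rewrite subrK.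
have -> : Q - P = - (P - Q) by rewrite opprB.
rewrite addrK; move: (X - P) (P - Q) (X - Y - _) => U V W.
rewrite !frob_inner_lin (frob_innerC W V). lra.
Qed.

End NearestPoint.

(** * The semidefinite cone: convexity, dyads, existence of nearest points *)

Section PsdCone.
Context {R : realType} {n : nat}.
Implicit Types A B P X Y : 'M[R]_n.

Lemma psd_cone_convex A B (s : R) : psd_cone A -> psd_cone B -> 0 <= s <= 1 ->
  psd_cone (A + s *: (B - A)).
Proof.
move=> [sA pA] [sB pB] /andP[s0 s1]; split=> [|x].
  by rewrite linearD linearZ linearB/= sA sB.
rewrite mulmxDr mulmxDl -scalemxAr -scalemxAl mulmxBr mulmxBl !mxE.
have := pA x; have := pB x; rewrite !mxE => H1 H2. nra.
Qed.

Lemma psd_cone0 : psd_cone (0 : 'M[R]_n).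
Proof. by split=> [|x]; [exact: trmx0|rewrite mulmx0 mul0mx mxE]. Qed.

Lemma psd_dyad (p : R) (v : 'cV[R]_n) : 0 <= p -> psd_cone (p *: (v *m v^T)).
Proof.
move=> p0; split=> [|x]; first by rewrite linearZ/= trmx_mul trmxK.
by rewrite -frob_inner_dyad frob_innerZr frob_inner_dyad2 mulr_ge0// sqr_ge0.
Qed.

(* Self-duality of the cone, for a matrix given as a sum of squares. *)
Lemma obtuse_dyad (p a b : R) (v l m : 'cV[R]_n) :
  0 <= p -> 0 <= a -> 0 <= b -> (l^T *m v) 0 0 = 0 -> (m^T *m v) 0 0 = 0 ->
  obtuse psd_cone
    (p *: (v *m v^T) - (a *: (l *m l^T) + b *: (m *m m^T))) (p *: (v *m v^T)).
Proof.
move=> p0 a0 b0 lv mv; split=> [|Y [_ pY]]; first exact: psd_dyad.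
rewrite addrAC subrr add0r frob_innerNl oppr_le0 !frob_inner_lin.
rewrite !frob_inner_dyad2 lv mv !frob_inner_dyad expr0n/=.
have := mulr_ge0 a0 (pY l); have := mulr_ge0 b0 (pY m); lra.
Qed.

Lemma continuous_vec_mx_entry i j :
  continuous (fun v : 'rV[R]_(n * n) => vec_mx v i j).
Proof.
have -> : (fun v : 'rV[R]_(n * n) => vec_mx v i j) =
    (fun v => v 0 (mxvec_index i j)) by apply/funext => v; rewrite mxE.
exact: coord_continuous.
Qed.

Lemma continuous_sum {T : topologicalType} {I : finType} (F : I -> T -> R) :
  (forall i, continuous (F i)) -> continuous (fun x => \sum_i F i x).
Proof. by move=> cF; apply: continuous_big => //; exact: add_continuous. Qed.

(** The squared distance to X attains its minimum on the compact set of cone points no farther from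
    X than 0 is. Matrices are flattened to row vectors because [EVT_min_rV] is stated for these. *)
Lemma nearest_points_psd X : nearest_points psd_cone X !=set0.
Proof.
pose f (v : 'rV[R]_(n * n)) := frob_inner (X - vec_mx v) (X - vec_mx v).
have cf : continuous f.
  rewrite (_ : f = fun v => \sum_i \sum_j (X i j - vec_mx v i j) ^+ 2).
    apply: continuous_sum => i; apply: continuous_sum => j v.
    apply: (@continuous_comp _ _ _ (fun v => X i j - vec_mx v i j)
      (fun r : R => r ^+ 2)); last exact: exprn_continuous.
    apply: continuousB; first exact: cst_continuous.
    exact: continuous_vec_mx_entry.
  apply/funext => v; rewrite /f frob_innerE.
  by do 2!(apply: eq_bigr => ? _); rewrite !mxE expr2.
pose K := [set v : 'rV[R]_(n * n) | psd_cone (vec_mx v) /\ f v <= frob_inner X X].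
have K0 : K !=set0.
  exists 0; rewrite /K /f/= linear0 subr0; split=> //; exact: psd_cone0.
have clK : closed K.
  (* The cone is cut out by closed conditions: one linear equation per pair of indices and, for each
     fixed x, one inequality that is linear in the matrix. *)
  rewrite (_ : K = ((\bigcap_(ij : 'I_n * 'I_n)
        [set v | vec_mx v ij.1 ij.2 - vec_mx v ij.2 ij.1 = 0]) `&`
      (\bigcap_(x : 'cV[R]_n) [set v | 0 <= (x^T *m vec_mx v *m x) 0 0])) `&`
      [set v | f v <= frob_inner X X]).
    apply: closedI; last exact: ((continuous_closedP f).1 cf _ (@closed_le _ _)).
    apply: closedI.
      apply: closed_bigI => -[i j] _.
      apply: ((continuous_closedP (fun v => vec_mx v i j - vec_mx v j i)).1 _
        [set x | x = 0] (@closed_eq _ _)) => v.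
      by apply: continuousB; exact: continuous_vec_mx_entry.
    apply: closed_bigI => x _.
    apply: ((continuous_closedP (fun v => (x^T *m vec_mx v *m x) 0 0)).1 _
      [set y | 0 <= y] (@closed_ge _ _)).
    rewrite (_ : (fun v => _) =
        fun v => \sum_j \sum_i x^T 0 i * x j 0 * vec_mx v i j); last first.
      apply/funext => v; rewrite mxE; apply: eq_bigr => j _.
      by rewrite mxE mulr_suml; apply: eq_bigr => i _; rewrite mulrAC.
    apply: continuous_sum => j; apply: continuous_sum => i v.
    apply: (@continuous_comp _ _ _ (fun v => vec_mx v i j)
      ( *%R (x^T 0 i * x j 0))); last exact: mulrl_continuous.
    exact: continuous_vec_mx_entry.
  apply/seteqP; split=> v.
    move=> [[sv pv] fv]; split=> //; split=> [ij _|x _]; last exact: pv.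
    by apply/eqP; rewrite /= subr_eq0 -{1}sv mxE.
  move=> [[sv pv] fv]; split=> //; split=> [|x]; last exact: pv.
  apply/matrixP => i j; rewrite mxE; apply/eqP; rewrite -subr_eq0; apply/eqP.
  exact: (sv (j, i)).
have bK : bounded_set K.
  (* Triangle inequality: an entry of a point of K is at most |X| plus its distance to X, itself at
     most |X|. *)
  exists (2 * frob_norm X); split; first exact: num_real.
  move=> M ltM v [_]; rewrite -frob_norm_le => fv.
  rewrite /Num.Def.normr/= mx_normrE; apply: bigmax_le => [|ij _].
    by rewrite (le_trans _ (ltW ltM))// mulr_ge0// sqrtr_ge0.
  rewrite (ord1 ij.1); case/mxvec_indexP: ij.2 => i j.
  have := le_trans (entry_le_frob_norm (X - vec_mx v) i j) fv.
  have := entry_le_frob_norm X i j; rewrite !mxE !ler_norml.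
  by move=> /andP[? ?] /andP[? ?]; apply/andP; split; lra.
have [v /set_mem[pv fv] minv] :=
  EVT_min_rV K0 (bounded_closed_compact bK clK) (continuous_subspaceT cf).
exists (vec_mx v); split=> // Y pY; rewrite frob_norm_le.
(* A cone point outside K is farther from X than 0 is, hence no better than the minimizer. *)
have [YX|/ltW XY] := leP (frob_inner (X - Y) (X - Y)) (frob_inner X X).
  have := minv (mxvec Y); rewrite /f mxvecK; apply.
  by apply/mem_set; split; rewrite /f mxvecK.
exact: le_trans XY.
Qed.

Lemma psd_proj_obtuse X : obtuse psd_cone X (psd_proj X).
Proof.
apply: nearest_point_obtuse; first exact: psd_cone_convex.
by have [P] := nearest_points_psd X; exact: xgetI.
Qed.

End PsdCone.

(** * Orders of vanishing at 0+ *)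

Section OrderAtZero.
Context {R : realType}.
Implicit Types (f g : R -> R) (c t : R) (m n k : nat).

Definition isO n f := exists C, \forall t \near 0^'+, `|f t| <= C * t ^+ n.

(** Eventual equality suffices, which admits [field] identities valid only where the denominators
    are nonzero. *)
Lemma isO_near {n f g} : isO n g -> (\forall t \near 0^'+, f t = g t) -> isO n f.
Proof.
move=> [C gC] fg; exists C; near=> t.
by rewrite (near fg t)//; near: t.
Unshelve. all: by end_near. Qed.

Lemma isO_ext {n f} g : isO n g -> f =1 g -> isO n f.
Proof. by move=> /isO_near gO fg; apply: gO; near=> t. Unshelve. all: by end_near. Qed.

Lemma isO_le m n f : isO m f -> (n <= m)%N -> isO n f.
Proof.
move=> [C fC] nm; exists C; near=> t.
have t0 : 0 < t by near: t; exact: nbhs_right_gt.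
have t1 : t < 1 by near: t; exact: nbhs_right_lt.
have fCt : `|f t| <= C * t ^+ m by near: t.
(* The sign of C is not part of [isO]; it is recovered from the bound at one t > 0. *)
have C0 : 0 <= C by rewrite -(pmulr_lge0 C (exprn_gt0 m t0)) (le_trans _ fCt).
by rewrite (le_trans fCt)// ler_wpM2l// ler_wiXn2l// ltW.
Unshelve. all: by end_near. Qed.

Lemma isO_cst c : isO 0 (fun=> c).
Proof. by exists `|c|; near=> t; rewrite expr0 mulr1. Unshelve. all: by end_near. Qed.

Lemma isO_cst0 n : isO n (fun=> 0).
Proof. by exists 0; near=> t; rewrite normr0 mul0r. Unshelve. all: by end_near. Qed.

Lemma isO_X n : isO n (fun t => t ^+ n).
Proof.
exists 1; near=> t; have t0 : 0 < t by near: t; exact: nbhs_right_gt.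
by rewrite mul1r ger0_norm// exprn_ge0// ltW.
Unshelve. all: by end_near. Qed.

Lemma isO_id : isO 1 (fun t => t).
Proof. exact: isO_ext (isO_X 1) _. Qed.

Lemma isOD m n f g : isO m f -> isO n g -> isO (minn m n) (fun t => f t + g t).
Proof.
move=> /(isO_le _ (minn m n))/(_ (geq_minl _ _)) [C fC].
move=> /(isO_le _ (minn m n))/(_ (geq_minr _ _)) [K gK].
exists (C + K); near=> t; rewrite mulrDl (le_trans (ler_normD _ _))// lerD//.
  by near: t.
by near: t.
Unshelve. all: by end_near. Qed.

Lemma isON n f : isO n f -> isO n (fun t => - f t).
Proof. by move=> [C fC]; exists C; near=> t; rewrite normrN; near: t.
Unshelve. all: by end_near. Qed.

Lemma isO_norm n f : isO n f -> isO n (fun t => `|f t|).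
Proof. by move=> [C fC]; exists C; near=> t; rewrite normr_id; near: t.
Unshelve. all: by end_near. Qed.

Lemma isOM m n f g : isO m f -> isO n g -> isO (m + n) (fun t => f t * g t).
Proof.
move=> [C fC] [K gK]; exists (C * K); near=> t.
by rewrite normrM exprD mulrACA ler_pM//; near: t.
Unshelve. all: by end_near. Qed.

Lemma isO_exp n f k : isO n f -> isO (n * k) (fun t => f t ^+ k).
Proof.
move=> fO; elim: k => [|k IH]; first by rewrite muln0; exact: isO_cst.
by rewrite mulnS; apply: (isO_ext (fun t => f t * f t ^+ k)) => [|t];
  [exact: isOM|rewrite exprS].
Qed.

Lemma isO1_lt f e : isO 1 f -> 0 < e -> \forall t \near 0^'+, `|f t| < e.
Proof.
move=> [C fC] e0; near=> t.
have t0 : 0 < t by near: t; exact: nbhs_right_gt.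
have te : t < e / (`|C| + 1).
  by near: t; apply: nbhs_right_lt; rewrite divr_gt0// ltr_wpDl.
have : `|f t| <= C * t ^+ 1 by near: t.
move=> /le_lt_trans; apply.
move: te; rewrite ltr_pdivlMr ?ltr_wpDl//.
have := ler_norm C; nra.
Unshelve. all: by end_near. Qed.

Lemma isO_neq0 f c : c != 0 -> isO 1 (fun t => f t - c) ->
  \forall t \near 0^'+, f t != 0.
Proof.
move=> c0 fc; have := isO1_lt _ `|c| fc; rewrite normr_gt0 => /(_ c0) fltc.
near=> t; apply: contraTneq isT => ft0.
by have := near fltc t; rewrite ft0 sub0r normrN ltxx; apply.
Unshelve. all: by end_near. Qed.

Lemma isO_gt0 f c : 0 < c -> isO 1 (fun t => f t - c) ->
  \forall t \near 0^'+, 0 < f t.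
Proof.
move=> c0 fc; have fltc := isO1_lt _ _ fc c0; near=> t.
have : `|f t - c| < c by near: t.
by rewrite ltr_norml => /andP[+ _]; rewrite ltrBrDl subrr.
Unshelve. all: by end_near. Qed.

(** Eventually |f| >= |c| / 2, so the reciprocal stays bounded. *)
Lemma isOV f c : c != 0 -> isO 1 (fun t => f t - c) -> isO 0 (fun t => (f t)^-1).
Proof.
move=> c0 fc; have c20 : 0 < `|c| / 2 by rewrite divr_gt0// normr_gt0.
have flt := isO1_lt _ _ fc c20.
exists (`|c| / 2)^-1; near=> t; rewrite expr0 mulr1 normfV.
have fct : `|f t - c| < `|c| / 2 by near: t.
have : `|c| / 2 <= `|f t|.
  have : `|c| <= `|c - f t| + `|f t| by rewrite -{1}(subrK (f t) c) ler_normD.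
  by rewrite distrC; lra.
move=> cf; rewrite lef_pV2// posrE//; exact: lt_le_trans cf.
Unshelve. all: by end_near. Qed.

Lemma isO_invB n f g c : c != 0 ->
  isO 1 (fun t => f t - c) -> isO 1 (fun t => g t - c) ->
  isO n (fun t => f t - g t) -> isO n (fun t => (f t)^-1 - (g t)^-1).
Proof.
move=> c0 fc gc fg.
apply: (@isO_near _ _ (fun t => (f t - g t) * (- ((f t)^-1 * (g t)^-1)))).
  rewrite -[n]addn0; apply: isOM => //; apply: isON.
  by rewrite -[0%N]addn0; apply: isOM; [exact: isOV fc|exact: isOV gc].
have f0 := isO_neq0 _ _ c0 fc; have g0 := isO_neq0 _ _ c0 gc.
near=> t; field.
by apply/andP; split; near: t.
Unshelve. all: by end_near. Qed.

Lemma isO_invB_cst f c : c != 0 ->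
  isO 1 (fun t => f t - c) -> isO 1 (fun t => (f t)^-1 - c^-1).
Proof.
move=> c0 fc; apply: (isO_invB _ _ (fun=> c) c c0) => //.
by apply: (isO_ext _ (isO_cst0 1)) => t; rewrite subrr.
Qed.

(** The error is at most C t times t^n, and C t eventually drops below c. *)
Lemma isO_gt0_pow n f c : 0 < c -> isO n.+1 (fun t => f t - c * t ^+ n) ->
  \forall t \near 0^'+, 0 < f t.
Proof.
move=> c0 [C fC]; have := isO1_lt (fun t => C * t) c _ c0.
have CO : isO 1 (fun t => C * t) by exact: isOM (isO_cst C) isO_id.
move=> /(_ CO) Ct; near=> t.
have tn0 : 0 < t ^+ n by rewrite exprn_gt0//; near: t; exact: nbhs_right_gt.
have : `|f t - c * t ^+ n| <= C * t ^+ n.+1 by near: t.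
have : `|C * t| < c by near: t.
rewrite exprSr ltr_norml ler_norml => /andP[_ H1] /andP[H2 _].
have : C * t * t ^+ n < c * t ^+ n by rewrite ltr_pM2r.
by move: H2; rewrite mulrA mulrAC => H2 H3; lra.
Unshelve. all: by end_near. Qed.

Lemma isO_sum n (I : finType) (F : I -> R -> R) :
  (forall i, isO n (F i)) -> isO n (fun t => \sum_i F i t).
Proof.
move=> FO; elim: (index_enum I) => [|i r IH].
  by apply: (isO_ext _ (isO_cst0 n)) => t; rewrite big_nil.
apply: (isO_ext (fun t => F i t + \sum_(j <- r) F j t)) => [|t]; last by rewrite big_cons.
by have := isOD _ _ _ _ (FO i) IH; rewrite minnn.
Qed.

Lemma isO_bigO n f : isO n f -> f =O_ (0^'+) (fun t : R => t ^+ n).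
Proof.
(* [eqO_exP] asks for a strictly positive constant. *)
move=> [C fC]; apply/eqO_exP; exists (`|C| + 1); first by rewrite ltr_wpDl.
suff key : \forall t \near 0^'+, `|f t| <= (`|C| + 1) * `|t ^+ n| by exact: key.
near=> t; have t0 : 0 < t by near: t; exact: nbhs_right_gt.
have fCt : `|f t| <= C * t ^+ n by near: t.
have tn0 : 0 <= t ^+ n by rewrite exprn_ge0// ltW.
rewrite (le_trans fCt)// [`|t ^+ n|]ger0_norm// ler_wpM2r//.
by have := ler_norm C; lra.
Unshelve. all: by end_near. Qed.

End OrderAtZero.

(* Syntactic, so that hypotheses about a compound such as [f t - g t] take
   precedence over its decomposition and no definition is unfolded. *)
Ltac isO_rec := match goal with
  | H : isO _ ?f |- isO _ ?g => constr_eq f g; exact H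
  | H : isO _ ?f |- isO _ (fun t => ?f t) => exact H
  | |- isO _ (fun t => t) => exact: isO_id
  | |- isO _ (fun t => t ^+ _) => exact: isO_X
  | |- isO _ (fun t => ?c) => exact: isO_cst
  | |- isO _ (fun t => @?f t + @?g t) => refine (isOD _ _ f g _ _); isO_rec
  | |- isO _ (fun t => - @?f t) => refine (isON _ f _); isO_rec
  | |- isO _ (fun t => @?f t * @?g t) => refine (isOM _ _ f g _ _); isO_rec
  | |- isO _ (fun t => @?f t ^+ ?k) => refine (isO_exp _ f k _); isO_rec
  | |- isO _ (fun t => `|@?f t|) => refine (isO_norm _ f _); isO_rec
  end.

(** The order is left as an existential variable that [isO_rec] fills in; comparing it with the goal
    is then a computation on numerals. *)
Ltac isO_solve := eapply isO_le; [isO_rec | done].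

(** * The curve G *)

Section Expansion.
Context {R : realType} (c1 c2 c3 c4 c5 : R) (hc4 : c4 != 0).
Implicit Types t : R.

Local Notation w := (w c1 c2 c3 c4 c5).
Local Notation tg13 := (tg13 c1 c2 c3 c4 c5).
Local Notation g13 := (g13 c1 c2 c3 c4 c5).
Local Notation g23 := (g23 c1 c2 c3 c4 c5).
Local Notation r13 := (r13 c1 c2 c3 c4 c5).
Local Notation r23 := (r23 c1 c2 c3 c4 c5).
Local Notation h := (h c1 c2 c3 c4 c5).

(** * Truncations of [w] and the denominators built from them *)

Let lin u t : R := c4 * u t + c5 * t.

Let isO_lin u : isO 1 (fun t => u t - 1) -> isO 1 (fun t => lin u t - c4).
Proof.
move=> uO; apply: (isO_ext (fun t => c4 * (u t - 1) + c5 * t)); first by isO_solve.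
by move=> t; rewrite /lin; ring.
Qed.

Let isO_linB n u v : isO n (fun t => u t - v t) ->
  isO n (fun t => lin u t - lin v t).
Proof.
move=> uO; apply: (isO_ext (fun t => c4 * (u t - v t))); first by isO_solve.
by move=> t; rewrite /lin; ring.
Qed.

Let isO_linV u : isO 1 (fun t => u t - 1) -> isO 0 (fun t => (lin u t)^-1).
Proof. by move=> /isO_lin; exact: isOV. Qed.

Let isO_linVB n u v : isO 1 (fun t => u t - 1) -> isO 1 (fun t => v t - 1) ->
  isO n (fun t => u t - v t) -> isO n (fun t => (lin u t)^-1 - (lin v t)^-1).
Proof. by move=> /isO_lin uO /isO_lin vO /isO_linB; exact: isO_invB uO vO. Qed.

(** [w0], [w1], [w2] are the truncations nested inside [w]. They serve to show that [w] solves w =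
    w0 + c2 t^2 / lin w + c3 t^3 / (lin w * w) up to O(t^6). *)
Let w0 t := 1 - 2 * c1 * t.
Let w1 t := w0 t + c2 * t ^+ 2 / lin w0 t + c3 * t ^+ 3 / c4.
Let w2 t := w0 t + c2 * t ^+ 2 / c4.

Let wE t : w t = w0 t + c2 * t ^+ 2 / lin w1 t + c3 * t ^+ 3 / (lin w2 t * w2 t).
Proof. by []. Qed.

Let w0B1 : isO 1 (fun t => w0 t - 1).
Proof.
apply: (isO_ext (fun t => - (2 * c1 * t))); first by isO_solve.
by move=> t; rewrite /w0; ring.
Qed.

Let w1B0 : isO 2 (fun t => w1 t - w0 t).
Proof.
have w0V := isO_linV w0 w0B1.
apply: (isO_ext (fun t => c2 * t ^+ 2 * (lin w0 t)^-1 + c3 * t ^+ 3 * c4^-1)).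
  by isO_solve.
by move=> t; rewrite /w1; ring.
Qed.

Let w2B0 : isO 2 (fun t => w2 t - w0 t).
Proof.
apply: (isO_ext (fun t => c2 * t ^+ 2 * c4^-1)); first by isO_solve.
by move=> t; rewrite /w2; ring.
Qed.

Let isO_trans n u v x : isO n (fun t => u t - v t) -> isO n (fun t => v t - x t) ->
  isO n (fun t => u t - x t).
Proof.
move=> uv vx; have := isOD _ _ _ _ uv vx; rewrite minnn => /isO_ext; apply=> t.
by rewrite addrA subrK.
Qed.

Let isO_inv1 u : isO 1 (fun t => u t - 1) -> isO 1 (fun t => (u t)^-1 - 1).
Proof. by move=> /(isO_invB_cst _ _ (oner_neq0 _)); rewrite invr1. Qed.

Let w1B1 : isO 1 (fun t => w1 t - 1).
Proof. exact: isO_trans (isO_le _ 1 _ w1B0 _) w0B1. Qed.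

Let w2B1 : isO 1 (fun t => w2 t - 1).
Proof. exact: isO_trans (isO_le _ 1 _ w2B0 _) w0B1. Qed.

Let w2V : isO 0 (fun t => (w2 t)^-1).
Proof. exact: isOV (oner_neq0 _) w2B1. Qed.

Lemma isO_wB1 : isO 1 (fun t => w t - 1).
Proof.
have l1 := isO_linV w1 w1B1; have l2 := isO_linV w2 w2B1.
apply: (isO_ext (fun t => (w0 t - 1) + c2 * t ^+ 2 * (lin w1 t)^-1 +
    c3 * t ^+ 3 * ((lin w2 t)^-1 * (w2 t)^-1))); first by isO_solve.
by move=> t; rewrite wE invfM; ring.
Qed.

(** The denominators [lin w1] and [lin w0] differ at order 2 and the factor t^2 adds two more
    orders; in the cubic term, [lin w2] and [w2] are within O(t) of c4 and 1. *)
Let wBw1 : isO 4 (fun t => w t - w1 t).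
Proof.
have d1 := isO_linVB _ _ _ w1B1 w0B1 w1B0.
have l2 := isO_linV w2 w2B1.
have d2 := isO_invB_cst _ _ hc4 (isO_lin _ w2B1).
have d3 := isO_inv1 w2 w2B1.
apply: (isO_ext (fun t => c2 * t ^+ 2 * ((lin w1 t)^-1 - (lin w0 t)^-1) +
   c3 * t ^+ 3 * (((lin w2 t)^-1 - c4^-1) * (w2 t)^-1 + c4^-1 * ((w2 t)^-1 - 1)))).
  by isO_solve.
by move=> t; rewrite wE /w1 invfM; ring.
Qed.

Let wBw2 : isO 3 (fun t => w t - w2 t).
Proof.
have l2 := isO_linV w2 w2B1; have d2 := isO_invB_cst _ _ hc4 (isO_lin _ w1B1).
apply: (isO_ext (fun t => c2 * t ^+ 2 * ((lin w1 t)^-1 - c4^-1) +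
   c3 * t ^+ 3 * ((lin w2 t)^-1 * (w2 t)^-1))); first by isO_solve.
by move=> t; rewrite wE /w2 invfM; ring.
Qed.

(** * Leading terms of [g13], [g23] and the top left entry of [G] *)

Let D t := 2 * c4 * w t + 2 * c5 * t.

Let DV t : (D t)^-1 = (lin w t)^-1 / 2.
Proof. by rewrite -invfM; congr (_^-1); rewrite /D /lin; ring. Qed.

Lemma isO_wV : isO 0 (fun t => (w t)^-1).
Proof. exact: isOV (oner_neq0 _) isO_wB1. Qed.

Lemma isO_wVB1 : isO 1 (fun t => (w t)^-1 - 1).
Proof. exact: isO_inv1 isO_wB1. Qed.

Lemma isO_DB : isO 1 (fun t => D t - 2 * c4).
Proof.
have wO := isO_wB1.
apply: (isO_ext (fun t => 2 * c4 * (w t - 1) + 2 * c5 * t)); first by isO_solve.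
by move=> t; rewrite /D; ring.
Qed.

Let c42 : 2 * c4 != 0.
Proof. by rewrite mulf_neq0// pnatr_eq0. Qed.

Lemma isO_DV : isO 0 (fun t => (D t)^-1).
Proof. exact: isOV c42 isO_DB. Qed.

Lemma isO_DVB : isO 1 (fun t => (D t)^-1 - (2 * c4)^-1).
Proof. exact: isO_invB_cst c42 isO_DB. Qed.

Lemma isO_tg13 : isO 6 (fun t => tg13 t - t ^+ 2 / D t).
Proof.
have := isO_DV => DO.
apply: (isO_ext (fun t => - (2 * (2 * c5 ^+ 2 + 1)) * t ^+ 6 * (D t)^-1 ^+ 5)).
  by isO_solve.
by move=> t; rewrite /tg13 -/(D t) exprVn; ring.
Qed.

Lemma isO_r13 : isO 7 r13.
Proof. by rewrite /r13; isO_solve. Qed.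

Lemma isO_r23 : isO 6 r23.
Proof.
have := isO_DV => DO; have := isO_wV => wO.
apply: (isO_ext (fun t => - (2 * c5 * t ^+ 6 * ((D t)^-1 ^+ 4 * (w t)^-1)) +
   r0 c1 c2 c3 c4 c5 * t ^+ 7)); first by isO_solve.
by move=> t; rewrite /r23 -/(D t) invfM exprVn.
Qed.

Lemma isO_g13 : isO 6 (fun t => g13 t - t ^+ 2 / D t).
Proof.
have := isO_tg13 => tO; have rO := isO_r13.
apply: (isO_ext (fun t => (tg13 t - t ^+ 2 / D t) + r13 t)); first by isO_solve.
by move=> t; rewrite /g13; ring.
Qed.

Lemma isO_g23 : isO 6 (fun t => g23 t + t ^+ 3 / (D t * w t)).
Proof.
have := isO_tg13 => tO; have rO := isO_r23; have wO := isO_wV.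
apply: (isO_ext (fun t => - ((tg13 t - t ^+ 2 / D t) * (w t)^-1 * t) + r23 t)).
  by isO_solve.
by move=> t; rewrite /g23 invfM; ring.
Qed.

Definition G11 t := 1 - 2 * c1 * t + 2 * c2 * g13 t - 2 * c3 * g23 t.

(** Inserting the leading terms of [g13] and [g23] yields the approximate fixed-point equation of
    [w]. Replacing w by [w1] under t^2 (error t^4) and by [w2] under t^3 (error t^3) both cost
    t^6. *)
Lemma isO_G11Bw : isO 6 (fun t => G11 t - w t).
Proof.
have g1 := isO_g13; have g2 := isO_g23.
have d1 := isO_linVB _ _ _ isO_wB1 w1B1 wBw1.
have d2 := isO_linVB _ _ _ isO_wB1 w2B1 wBw2.
have d3 := isO_invB _ _ _ _ (oner_neq0 _) isO_wB1 w2B1 wBw2.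
have wV := isO_wV; have l2 := isO_linV w2 w2B1.
apply: (isO_ext (fun t => 2 * c2 * (g13 t - t ^+ 2 / D t)
  - 2 * c3 * (g23 t + t ^+ 3 / (D t * w t))
  + c2 * t ^+ 2 * ((lin w t)^-1 - (lin w1 t)^-1)
  + c3 * t ^+ 3 * (((lin w t)^-1 - (lin w2 t)^-1) * (w t)^-1
      + (lin w2 t)^-1 * ((w t)^-1 - (w2 t)^-1)))); first by isO_solve.
move=> t; rewrite [in LHS]wE /G11 !invfM DV /w0.
by move: (g13 t) (g23 t) (lin w t)^-1 (w t)^-1 (lin w1 t)^-1 (lin w2 t)^-1 (w2 t)^-1 => *; field.
Qed.

(** Coefficients of the t^7 terms of the correction; [kappa] is also the leading coefficient of [h],
    at t^6. *)
Let e22 : R := frob_inner (B2 c2 c4) (B1 c1) / (8 * c4 ^+ 5 * frob_norm (B1 c1) ^+ 2).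
Let e32 : R := frob_inner (B3 c3 c5) (B1 c1) / (8 * c4 ^+ 4 * frob_norm (B1 c1) ^+ 2).
Let kappa : R := (8 * c4 ^+ 4)^-1.

(** The first two summands cancel the t^7 terms of [E32]; the third matches c4 t h in entry (3,2) of
    the rank-one matrix. *)
Lemma r0E : r0 c1 c2 c3 c4 c5 = e32 + c5 * e22 + c4 * kappa.
Proof.
rewrite /r0 /e22 /e32 /kappa; move: (frob_norm _ ^+ 2) => n; rewrite !(invfM _ n).
by move: (frob_inner _ _) (frob_inner _ _) n^-1 => *; field.
Qed.

(** This coefficient makes 2 c4 r13 - 2 c5 r0 t^7 equal to e22 t^7, which is what [E22]
    subtracts. *)
Lemma r13E t :
  r13 t = (c5 / c4 * r0 c1 c2 c3 c4 c5 + e22 / (2 * c4)) * t ^+ 7.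
Proof.
rewrite /r13 /e22; move: (frob_norm _ ^+ 2) => n; rewrite !(invfM _ n).
by move: (r0 _ _ _ _ _) (frob_inner _ _) n^-1 => *; field.
Qed.

Definition E22 t := h t - e22 * t ^+ 7.
Definition E32 t := c5 * h t - c5 * e22 * t ^+ 7 - e32 * t ^+ 7.
Definition E33 t := g13 t ^+ 2 / w t.

(** With [v3], chosen so that G11 (1, v2, v3) is exactly the first column of the corrected
    matrix. *)
Definition v2 t := (t - kappa * t ^+ 7) / G11 t.
Definition v3 t := (c4 * h t - g13 t) / G11 t.

Lemma w_neq0 : \forall t \near 0^'+, w t != 0.
Proof. exact: isO_neq0 (oner_neq0 _) isO_wB1. Qed.

Lemma D_neq0 : \forall t \near 0^'+, D t != 0.
Proof. exact: isO_neq0 c42 isO_DB. Qed.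

Lemma isO_G11B1 : isO 1 (fun t => G11 t - 1).
Proof. exact: isO_trans (isO_le _ 1 _ isO_G11Bw _) isO_wB1. Qed.

Lemma isO_G11V : isO 0 (fun t => (G11 t)^-1).
Proof. exact: isOV (oner_neq0 _) isO_G11B1. Qed.

Lemma G11_gt0 : \forall t \near 0^'+, 0 < G11 t.
Proof. exact: isO_gt0 ltr01 isO_G11B1. Qed.

Lemma isO_G11VB1 : isO 1 (fun t => (G11 t)^-1 - 1).
Proof. exact: isO_inv1 isO_G11B1. Qed.

Lemma isO_G11VBwV : isO 6 (fun t => (G11 t)^-1 - (w t)^-1).
Proof. exact: isO_invB (oner_neq0 _) isO_G11B1 isO_wB1 isO_G11Bw. Qed.

Lemma hE t : h t = 2 * t ^+ 6 * ((D t)^-1 ^+ 4 * (w t)^-1).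
Proof. by rewrite /h -/(D t) invfM exprVn. Qed.

Lemma isO_h : isO 6 h.
Proof.
have DV0 := isO_DV; have wV := isO_wV.
apply: (isO_ext (fun t => 2 * t ^+ 6 * ((D t)^-1 ^+ 4 * (w t)^-1))); last exact: hE.
by isO_solve.
Qed.

Lemma isO_hB : isO 7 (fun t => h t - kappa * t ^+ 6).
Proof.
have DV0 := isO_DV; have wV := isO_wV.
have DB := isO_DVB; have wVB := isO_wVB1.
pose k := (2 * c4)^-1.
(* Difference of fourth powers, factored to expose D^-1 - k. *)
apply: (isO_ext (fun t => 2 * t ^+ 6 * (((D t)^-1 - (2 * c4)^-1) *
   ((D t)^-1 ^+ 3 + (D t)^-1 ^+ 2 * k + (D t)^-1 * k ^+ 2 + k ^+ 3) * (w t)^-1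
   + k ^+ 4 * ((w t)^-1 - 1)))); first by isO_solve.
move=> t; rewrite hE /kappa -/k.
have -> : (8 * c4 ^+ 4)^-1 = 2 * k ^+ 4 by rewrite /k; field.
by ring.
Qed.

Lemma isO_g13_2 : isO 2 g13.
Proof.
have gO := isO_g13; have DO := isO_DV.
apply: (isO_ext (fun t => (g13 t - t ^+ 2 / D t) + t ^+ 2 * (D t)^-1)).
  by isO_solve.
by move=> t; rewrite subrK.
Qed.

Lemma isO_g13B : isO 3 (fun t => g13 t - (2 * c4)^-1 * t ^+ 2).
Proof.
have gO := isO_g13; have DO := isO_DVB.
apply: (isO_ext (fun t => (g13 t - t ^+ 2 / D t) + t ^+ 2 * ((D t)^-1 - (2 * c4)^-1))).
  by isO_solve.
by move=> t; ring.
Qed.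

Lemma isO_E22 : isO 6 E22.
Proof. by have hO := isO_h; rewrite /E22; isO_solve. Qed.

Lemma isO_E32 : isO 6 E32.
Proof. by have hO := isO_h; rewrite /E32; isO_solve. Qed.

Lemma isO_E33 : isO 4 E33.
Proof. by have gO := isO_g13_2; have wO := isO_wV; rewrite /E33; isO_solve. Qed.

Lemma isO_v2 : isO 1 v2.
Proof. by have aO := isO_G11V; rewrite /v2; isO_solve. Qed.

Lemma isO_v3 : isO 2 v3.
Proof.
by have aO := isO_G11V; have hO := isO_h; have gO := isO_g13_2; rewrite /v3; isO_solve.
Qed.

(** The [tg13] terms combine to tg13 D / w. With T = t^6 / (D^4 w), this contributes t^2 / w - 2 (2
    c5^2 + 1) T, while [r23] gives 4 c5^2 T and [h] is 2 T: the T terms cancel, and so do the t^7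
    terms. *)
Lemma G22E : \forall t \near 0^'+,
  2 * c4 * g13 t - 2 * c5 * g23 t + E22 t = t ^+ 2 / w t.
Proof.
have w_0 := w_neq0; have D_0 := D_neq0; near=> t.
have : D t != 0 by near: t.
have : w t != 0 by near: t.
rewrite /E22 /g13 /g23 r13E /r23 /h /tg13 /D.
move: (w t) (r0 _ _ _ _ _) e22 => W r e W0 D0; field.
by rewrite hc4 W0 D0.
Unshelve. all: by end_near. Qed.

Lemma G23E t : g23 t + E32 t = c4 * kappa * t ^+ 7 - tg13 t / w t * t.
Proof.
by rewrite /E32 /g23 /r23 r0E /h -/(D t); move: (tg13 t / w t) (D t ^+ 4 * w t)^-1 => *; ring.
Qed.

(** Up to O(t^8), G11 v2^2 is t^2 / G11, and exchanging G11 for w there costs t^2 O(t^6). *)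
Lemma E22_res : isO 8
  (fun t => 2 * c4 * g13 t - 2 * c5 * g23 t + E22 t - G11 t * v2 t ^+ 2).
Proof.
have aO := isO_G11V; have aw := isO_G11VBwV; have a0 := G11_gt0; have GE := G22E.
apply: (@isO_near _ _ _ (fun t => - (t ^+ 2 * ((G11 t)^-1 - (w t)^-1))
   + 2 * kappa * t ^+ 8 * (G11 t)^-1 - kappa ^+ 2 * t ^+ 14 * (G11 t)^-1)).
  by isO_solve.
near=> t.
have at0 : G11 t != 0 by rewrite gt_eqF//; near: t.
rewrite (near GE t)// /v2.
by move: (w t)^-1 (G11 t) at0 => *; field.
Unshelve. all: by end_near. Qed.

(** The product G11 v2 v3 is (c4 t h - t g13) / G11 up to O(t^8); its two parts match the two terms
    of [G23E], since h = kappa t^6 + O(t^7) and g13 - tg13 = r13 = O(t^7). *)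
Lemma E32_res : isO 8 (fun t => g23 t + E32 t - G11 t * v2 t * v3 t).
Proof.
have aO := isO_G11V; have aw := isO_G11VBwV; have a0 := G11_gt0; have wO := isO_wV.
have hO := isO_h; have hB := isO_hB; have aB := isO_G11VB1; have gO := isO_g13_2.
have rO := isO_r13.
apply: (@isO_near _ _ _ (fun t => t * g13 t * ((G11 t)^-1 - (w t)^-1)
   + t * r13 t * (w t)^-1 - c4 * t * (h t - kappa * t ^+ 6)
   - c4 * t * h t * ((G11 t)^-1 - 1)
   + kappa * t ^+ 7 * (c4 * h t - g13 t) * (G11 t)^-1)); first by isO_solve.
near=> t.
have at0 : G11 t != 0 by rewrite gt_eqF//; near: t.
rewrite G23E /v2 /v3 /g13.
by move: (w t)^-1 (G11 t) at0 => *; field.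
Unshelve. all: by end_near. Qed.

Lemma E33_res : isO 8 (fun t => E33 t - G11 t * v3 t ^+ 2).
Proof.
have aO := isO_G11V; have aw := isO_G11VBwV; have a0 := G11_gt0.
have hO := isO_h; have gO := isO_g13_2.
apply: (@isO_near _ _ _ (fun t => - (g13 t ^+ 2 * ((G11 t)^-1 - (w t)^-1))
   + 2 * c4 * h t * g13 t * (G11 t)^-1 - c4 ^+ 2 * h t ^+ 2 * (G11 t)^-1)).
  by isO_solve.
near=> t.
have at0 : G11 t != 0 by rewrite gt_eqF//; near: t.
rewrite /E33 /v3.
by move: (w t)^-1 (G11 t) at0 => *; field.
Unshelve. all: by end_near. Qed.

(** The leading part of E22 v2 is t h, about kappa t^7; this is what fixes entry (2,1) of the
    correction. *)
Lemma E21_res : isO 8 (fun t => kappa * t ^+ 7 - (E22 t * v2 t + E32 t * v3 t)).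
Proof.
have aO := isO_G11V; have EO := isO_E32; have zO := isO_v3; have yO := isO_v2.
have hO := isO_h; have hB := isO_hB; have aB := isO_G11VB1.
apply: (isO_ext (fun t => - (t * (h t - kappa * t ^+ 6)) - t * h t * ((G11 t)^-1 - 1)
   + kappa * t ^+ 7 * h t * (G11 t)^-1 + e22 * t ^+ 7 * v2 t - E32 t * v3 t)).
  by isO_solve.
by move=> t; rewrite /E22 /v2; ring.
Qed.

Lemma E31_res : isO 8 (fun t => c4 * h t + v2 t * E32 t + v3 t * E33 t).
Proof.
have aO := isO_G11V; have aw := isO_G11VBwV; have zO := isO_v3; have yO := isO_v2.
have hO := isO_h; have gO := isO_g13_2; have gD := isO_g13.
have DO := isO_DV; have wO := isO_wV; have w_0 := w_neq0; have D_0 := D_neq0.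
apply: (@isO_near _ _ _ (fun t =>
   - (v2 t * (c5 * e22 + e32) * t ^+ 7)
   - c5 * kappa * t ^+ 7 * h t * (G11 t)^-1
   + c5 * t * h t * ((G11 t)^-1 - (w t)^-1)
   + c4 * h t * (G11 t)^-1 * g13 t ^+ 2 * (w t)^-1
   - g13 t ^+ 3 * (w t)^-1 * ((G11 t)^-1 - (w t)^-1)
   - (g13 t - t ^+ 2 / D t) * (g13 t ^+ 2 + g13 t * t ^+ 2 * (D t)^-1
      + t ^+ 4 * (D t)^-1 ^+ 2) * (w t)^-1 ^+ 2)); first by isO_solve.
near=> t.
have Dt0 : D t != 0 by near: t.
have wt0 : w t != 0 by near: t.
(* The left side is h D / (2 w). The right side is (t^2 / D)^3 / w^2, which cancels the leading part
   -g13^3 / w^2 of v3 E33; the remainder is a factored difference of cubes. *)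
have hD : c4 * h t + c5 * t * h t / w t = t ^+ 6 * (D t)^-1 ^+ 3 * (w t)^-1 ^+ 2.
  move: Dt0 wt0; rewrite /h /D; move: (w t) => W D0 W0; field.
  by rewrite W0 D0.
have {}hD : c4 * h t = t ^+ 6 * (D t)^-1 ^+ 3 * (w t)^-1 ^+ 2 - c5 * t * h t / w t.
  by rewrite -hD addrK.
rewrite {1}hD /E32 /E33 /v3 /v2.
by move: (w t)^-1 (G11 t)^-1 (D t)^-1 => *; ring.
Unshelve. all: by end_near. Qed.

Lemma E11_res : isO 8 (fun t =>
  v2 t ^+ 2 * E22 t + 2 * v2 t * v3 t * E32 t + v3 t ^+ 2 * E33 t).
Proof.
have yO := isO_v2; have zO := isO_v3; have E2 := isO_E22; have E3 := isO_E32.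
have E4 := isO_E33.
by isO_solve.
Qed.

(** * Positive definiteness of the lower right block *)

Let kappa_gt0 : 0 < kappa.
Proof. by rewrite /kappa invr_gt0 mulr_gt0// exprn_even_gt0. Qed.

Let mu : R := (2 * c4)^-1 ^+ 2.

Let mu_gt0 : 0 < mu.
Proof. by rewrite /mu exprn_even_gt0//= invr_eq0. Qed.

Let isO_E33B : isO 5 (fun t => E33 t - mu * t ^+ 4).
Proof.
have gB := isO_g13B; have gO := isO_g13_2; have wO := isO_wV; have wB := isO_wVB1.
apply: (isO_ext (fun t => (g13 t - (2 * c4)^-1 * t ^+ 2) *
  (g13 t + (2 * c4)^-1 * t ^+ 2) * (w t)^-1 + mu * t ^+ 4 * ((w t)^-1 - 1))).
  by isO_solve.
by move=> t; rewrite /E33 /mu; ring.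
Qed.

Lemma E33_gt0 : \forall t \near 0^'+, 0 < E33 t.
Proof. exact: isO_gt0_pow mu_gt0 isO_E33B. Qed.

Lemma E_det_gt0 : \forall t \near 0^'+, 0 < E22 t * E33 t - E32 t ^+ 2.
Proof.
have E3B := isO_E33B; have hB := isO_hB; have E3 := isO_E33; have E2 := isO_E32.
(* The product of the diagonal leads with kappa t^6 * mu t^4, while E32^2 has order 12. *)
apply: (isO_gt0_pow 10 _ (kappa * mu)); first exact: mulr_gt0.
apply: (isO_ext (fun t => (h t - kappa * t ^+ 6) * E33 t - e22 * t ^+ 7 * E33 t +
  kappa * t ^+ 6 * (E33 t - mu * t ^+ 4) - E32 t ^+ 2)); first by isO_solve.
by move=> t; rewrite /E22; ring.
Qed.

(** * Assembly of the 3x3 matrices *)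

Lemma GE t : G c1 c2 c3 c4 c5 t =
  sym3 (G11 t) t (2 * c4 * g13 t - 2 * c5 * g23 t) (- g13 t) (g23 t) 0.
Proof.
apply/matrixP => i j; rewrite !mxE /G11.
by case: i => [[|[|[|]]]]//= ?; case: j => [[|[|[|]]]]//= ?; ring.
Qed.

Definition rank1 a y z : 'M[R]_3 :=
  sym3 a (a * y) (a * y ^+ 2) (a * z) (a * y * z) (a * z ^+ 2).

(* The symmetric matrix annihilating (1, y, z) with given lower right block. *)
Definition kernel_ext y z n22 n32 n33 : 'M[R]_3 :=
  sym3 (y ^+ 2 * n22 + 2 * y * z * n32 + z ^+ 2 * n33)
    (- (n22 * y + n32 * z)) n22 (- (y * n32 + z * n33)) n32 n33.

(** Completing the square writes the subtracted matrix as n33 l l^T plus the Schur complement times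
    m m^T, with l and m orthogonal to (1, y, z). *)
Lemma obtuse_rank1 p y z n22 n32 n33 :
  0 <= p -> 0 < n33 -> n32 ^+ 2 <= n22 * n33 ->
  obtuse psd_cone (rank1 p y z - kernel_ext y z n22 n32 n33) (rank1 p y z).
Proof.
move=> p0 n0 nn; pose q := n32 / n33.
pose col3 (x1 x2 x3 : R) : 'cV[R]_3 := \col_i nth 0 [:: x1; x2; x3] i.
pose v := col3 1 y z; pose l := col3 (- (y * q + z)) q 1.
pose m := col3 (- y) 1 0.
have n33n0 : n33 != 0 by rewrite gt_eqF.
have -> : rank1 p y z = p *: (v *m v^T).
  apply/matrixP => i j; rewrite !mxE big_ord1 !mxE.
  by case: i => [[|[|[|]]]]//= ?; case: j => [[|[|[|]]]]//= ?; ring.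
have -> : kernel_ext y z n22 n32 n33 =
    n33 *: (l *m l^T) + (n22 - n32 ^+ 2 / n33) *: (m *m m^T).
  apply/matrixP => i j; rewrite !mxE !big_ord1 !mxE /q.
  by case: i => [[|[|[|]]]]//= ?; case: j => [[|[|[|]]]]//= ?; field.
apply: obtuse_dyad => //; first exact: ltW.
- by rewrite subr_ge0 ler_pdivrMr.
- by rewrite !mxE !big_ord_recl big_ord0 !mxE/=; ring.
- by rewrite !mxE !big_ord_recl big_ord0 !mxE/=; ring.
Qed.

Lemma isO_sym3 n (f1 f2 f3 f4 f5 f6 : R -> R) i j :
  isO n f1 -> isO n f2 -> isO n f3 -> isO n f4 -> isO n f5 -> isO n f6 ->
  isO n (fun t => sym3 (f1 t) (f2 t) (f3 t) (f4 t) (f5 t) (f6 t) i j).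
Proof.
move=> O1 O2 O3 O4 O5 O6; case: i j => [[|[|[|i]]] i3] [[|[|[|j]]] j3] //.
all: first [by apply: (isO_ext _ O1) => t; rewrite mxE
  | by apply: (isO_ext _ O2) => t; rewrite mxE
  | by apply: (isO_ext _ O3) => t; rewrite mxE
  | by apply: (isO_ext _ O4) => t; rewrite mxE
  | by apply: (isO_ext _ O5) => t; rewrite mxE
  | by apply: (isO_ext _ O6) => t; rewrite mxE ].
Qed.

Let P t := rank1 (G11 t) (v2 t) (v3 t).
Let N t := kernel_ext (v2 t) (v3 t) (E22 t) (E32 t) (E33 t).
Let E t := sym3 0 (- (kappa * t ^+ 7)) (E22 t) (c4 * h t) (E32 t) (E33 t).

Let G11v2E t : G11 t != 0 -> G11 t * v2 t = t - kappa * t ^+ 7.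
Proof. by move=> a0; rewrite /v2 mulrC divfK. Qed.

Let G11v3E t : G11 t != 0 -> G11 t * v3 t = c4 * h t - g13 t.
Proof. by move=> a0; rewrite /v3 mulrC divfK. Qed.

Lemma isO_G_residual i j :
  isO 8 (fun t => (G c1 c2 c3 c4 c5 t - (P t - N t)) i j).
Proof.
have a0 := G11_gt0.
apply: (@isO_near _ _ _ (fun t => sym3
  (v2 t ^+ 2 * E22 t + 2 * v2 t * v3 t * E32 t + v3 t ^+ 2 * E33 t)
  (kappa * t ^+ 7 - (E22 t * v2 t + E32 t * v3 t))
  (2 * c4 * g13 t - 2 * c5 * g23 t + E22 t - G11 t * v2 t ^+ 2)
  (- (c4 * h t + v2 t * E32 t + v3 t * E33 t))
  (g23 t + E32 t - G11 t * v2 t * v3 t)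
  (E33 t - G11 t * v3 t ^+ 2) i j)).
  apply: isO_sym3; [exact: E11_res|exact: E21_res|exact: E22_res| |
    exact: E32_res|exact: E33_res].
  exact: isON E31_res.
near=> t; have at0 : G11 t != 0 by rewrite gt_eqF//; near: t.
rewrite GE /P /N /rank1 /kernel_ext !mxE (G11v2E _ at0) (G11v3E _ at0).
by case: i => [[|[|[|]]]]//= ?; case: j => [[|[|[|]]]]//= ?; ring.
Unshelve. all: by end_near. Qed.

(** The first row and column agree exactly by the choice of [v2] and [v3], so only the lower block
    leaves a residual. *)
Lemma isO_P_residual i j :
  isO 8 (fun t => (P t - (G c1 c2 c3 c4 c5 t + E t)) i j).
Proof.
have a0 := G11_gt0.
apply: (@isO_near _ _ _ (fun t => sym3 0 0
  (- (2 * c4 * g13 t - 2 * c5 * g23 t + E22 t - G11 t * v2 t ^+ 2))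
  0 (- (g23 t + E32 t - G11 t * v2 t * v3 t)) (- (E33 t - G11 t * v3 t ^+ 2)) i j)).
  have O0 : isO 8 (fun=> 0 : R) by exact: isO_cst0.
  apply: isO_sym3 => //; apply: isON; [exact: E22_res|exact: E32_res|exact: E33_res].
near=> t; have at0 : G11 t != 0 by rewrite gt_eqF//; near: t.
rewrite GE /P /E /rank1 !mxE (G11v2E _ at0) (G11v3E _ at0).
by case: i => [[|[|[|]]]]//= ?; case: j => [[|[|[|]]]]//= ?; ring.
Unshelve. all: by end_near. Qed.

(** Since [P] satisfies the obtuse-angle inequality for [P - N], nonexpansiveness bounds the
    distance from the projection of [G] to [P] by |G - (P - N)|; the triangle inequality through [P]
    concludes. *)
Lemma isO_psd_proj i j :
  isO 8 (fun t => psd_proj (G c1 c2 c3 c4 c5 t) i j - (G c1 c2 c3 c4 c5 t + E t) i j).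
Proof.
have [C bound] : isO 8 (fun t =>
    \sum_i \sum_j `|(G c1 c2 c3 c4 c5 t - (P t - N t)) i j|).
  by do 2!(apply: isO_sum => ?); apply: isO_norm; exact: isO_G_residual.
have [K boundP] := isO_P_residual i j.
have a0 := G11_gt0; have E0 := E33_gt0; have det0 := E_det_gt0.
exists (C + K); near=> t.
have oP : obtuse psd_cone (P t - N t) (P t).
  apply: obtuse_rank1; first by apply: ltW; near: t.
    by near: t.
  by rewrite -subr_ge0; apply: ltW; near: t.
have := obtuse_nonexpansive _ _ _ _ _ (psd_proj_obtuse (G c1 c2 c3 c4 c5 t)) oP.
move=> /(le_trans (entry_le_frob_norm _ i j))/le_trans.
move=> /(_ _ (frob_norm_le_sum _)) d1.
have b1 : `|\sum_i \sum_j `|(G c1 c2 c3 c4 c5 t - (P t - N t)) i j| | <= C * t ^+ 8.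
  by near: t.
have b2 : `|(P t - (G c1 c2 c3 c4 c5 t + E t)) i j| <= K * t ^+ 8 by near: t.
have -> : psd_proj (G c1 c2 c3 c4 c5 t) i j - (G c1 c2 c3 c4 c5 t + E t) i j =
    (psd_proj (G c1 c2 c3 c4 c5 t) - P t) i j + (P t - (G c1 c2 c3 c4 c5 t + E t)) i j.
  by rewrite !mxE addrA subrK.
rewrite mulrDl (le_trans (ler_normD _ _))// lerD//.
by rewrite (le_trans d1)// (le_trans (ler_norm _)).
Unshelve. all: by end_near. Qed.

End Expansion.

Theorem theorem6p2 (R : realType) (c1 c2 c3 c4 c5 : R) (hc4 : c4 != 0) :
  let B1 := B1 c1 in
  let B2 := B2 c2 c4 in
  let B3 := B3 c3 c5 in
  let w := w c1 c2 c3 c4 c5 in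
  let g13 := g13 c1 c2 c3 c4 c5 in
  let h := h c1 c2 c3 c4 c5 in
  let G := G c1 c2 c3 c4 c5 in
  let E (t : R) := sym3
    0
    (- (t ^+ 7 / (8 * c4 ^+ 4)))
    (h t - frob_inner B2 B1 / (8 * c4 ^+ 5 * frob_norm B1 ^+ 2) * t ^+ 7)
    (c4 * h t)
    (c5 * h t
     - c5 * frob_inner B2 B1 / (8 * c4 ^+ 5 * frob_norm B1 ^+ 2) * t ^+ 7
     - frob_inner B3 B1 / (8 * c4 ^+ 4 * frob_norm B1 ^+ 2) * t ^+ 7)
    (g13 t ^+ 2 / w t) in
  forall i j : 'I_3,
    (fun t : R => psd_proj (G t) i j - (G t + E t) i j)
      =O_ (0^'+) (fun t : R => t ^+ 8).
Proof.
move=> B1 B2 B3 w g13 h G E i j; apply: isO_bigO.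
apply: (isO_ext _ (isO_psd_proj c1 c2 c3 c4 c5 hc4 i j)) => t.
by rewrite /E [t ^+ 7 / _]mulrC -[c5 * _ / _]mulrA.
Qed.
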